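(* Let $d\ge 1$ and let $f(z)=\sum_{k=0}^n c_k e^{\langle\lambda_k,z\rangle}$, $z\in\mathbb{C}^d$, be a polynomial exponential sum, i.e. $c_k\in\mathbb{C}\setminus\{0\}$ and $\lambda_0,\dots,\lambda_n\in\mathbb{Z}^d$ are pairwise distinct. Let $\delta$ be a real number with $$\delta\ \ge\ d\,\log\big(2+\sqrt{3}\big).$$ If $x\in\mathbb{R}^d$ is of Euclidean distance at least $\delta$ from the Archimedean tropical variety $\mathscr{T}(f)$, then $x\in\mathbb{R}^d\setminus\mathscr{A}(f)$, where $\mathscr{A}(f)$ is the amoeba of $f$.
   Context: For $\lambda\in\mathbb{R}^d$ and $z\in\mathbb{C}^d$, $\langle\lambda,z\rangle=\sum_j\lambda_j z_j$ (bilinear). The amoeba of $f$ is $\mathscr{A}(f)=\{\Re(z) : z\in\mathbb{C}^d,\ f(z)=0\}\subset\mathbb{R}^d$, where $\Re$ is the componentwise real part. The Archimedean tropical variety $\mathscr{T}(f)\subset\mathbb{R}^d$ is the tropical variety of $\hat f(x)=\max_{k=0,\dots,n}\left(\log|c_k|+\langle\lambda_k,x\rangle\right)$, i.e. the set of points $x\in\mathbb{R}^d$ at which this maximum is attained by at least two distinct indices $k$. (The distance to the empty set is taken to be $+\infty$.) *)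

(* Defs.v *)
From mathcomp Require Import all_boot all_order all_algebra.
From mathcomp Require Import complex.
From mathcomp Require Import all_classical all_reals all_analysis.
Set Implicit Arguments.
Unset Strict Implicit.
Unset Printing Implicit Defensive.
Import Order.TTheory GRing.Theory Num.Theory.
Local Open Scope classical_set_scope.
Local Open Scope ring_scope.
Local Open Scope complex_scope.

(* [K] is instantiated with both the reals and the complex numbers; the pairing
   is bilinear, with no conjugation. *)
Definition pairing (K : comNzRingType) (d : nat) (l : 'rV[int]_d)
  (z : 'rV[K]_d) : K := \sum_(j < d) (l 0 j)%:~R * z 0 j.

Definition cexp (R : realType) (z : R[i]) : R[i] :=
  (expR (complex.Re z))%:C * (cos (complex.Im z) +i* sin (complex.Im z)).

Definition exp_sum (R : realType) (d n : nat) (c : 'I_n.+1 -> R[i])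
  (lambda : 'I_n.+1 -> 'rV[int]_d) (z : 'rV[R[i]]_d) : R[i] :=
  \sum_(k < n.+1) c k * cexp (pairing (lambda k) z).

Definition amoeba (R : realType) (d : nat) (f : 'rV[R[i]]_d -> R[i]) :
  set 'rV[R]_d :=
  [set map_mx (@complex.Re R) z | z in [set z | f z = 0]].

(* [normc] is the modulus as an element of [R]; [`|c k|] would be in [R[i]]. *)
Definition trop_term (R : realType) (d n : nat) (c : 'I_n.+1 -> R[i])
  (lambda : 'I_n.+1 -> 'rV[int]_d) (x : 'rV[R]_d) (k : 'I_n.+1) : R :=
  ln (Normc.normc (c k)) + pairing (lambda k) x.

(* The maximum of a nonempty family: the default value of the iterated [max] is
   itself one of the terms. *)
Definition trop_poly (R : realType) (d n : nat) (c : 'I_n.+1 -> R[i])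
  (lambda : 'I_n.+1 -> 'rV[int]_d) (x : 'rV[R]_d) : R :=
  \big[Order.max/trop_term c lambda x ord0]_(k < n.+1) trop_term c lambda x k.

Definition arch_trop_variety (R : realType) (d n : nat) (c : 'I_n.+1 -> R[i])
  (lambda : 'I_n.+1 -> 'rV[int]_d) : set 'rV[R]_d :=
  [set x | exists k l : 'I_n.+1,
     [/\ k != l, trop_term c lambda x k = trop_poly c lambda x
       & trop_term c lambda x l = trop_poly c lambda x]].

(* The canonical norm of ['rV[R]_d] is the sup norm, hence a separate
   definition. *)
Definition eucl_dist (R : realType) (d : nat) (x y : 'rV[R]_d) : R :=
  Num.sqrt (\sum_(j < d) (x 0 j - y 0 j) ^+ 2).

(* Valued in the extended reals, so that the distance to [set0] is [+oo]. *)
Definition eucl_dist_set (R : realType) (d : nat) (x : 'rV[R]_d)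
  (A : set 'rV[R]_d) : \bar R :=
  ereal_inf [set (eucl_dist x y)%:E | y in A].

(* Main.v *)
(* Let [k0] be the leading index at [x]. Following the direction
   [lambda k - lambda k0] until some term catches up with the leading one reaches
   the tropical variety, so at distance [delta] from it
   [|c_k e^<lambda_k, x>| <= e^(- delta |lambda k - lambda k0|_2) |c_k0 e^<lambda_k0, x>|].
   Since [d |m|_2 >= sqrt d |m|_1], the quotients of the terms [k != k0] by the
   leading one have total at most the sum of [r ^ |m|_1] over nonzero integer
   vectors [m], which is [((1 + r) / (1 - r)) ^ d - 1] for
   [r = (2 + sqrt 3) ^ (- sqrt d)]. This is smaller than [1] for every [d], so the
   leading term cannot be cancelled. *)
Require Import Defs.
From mathcomp Require Import all_boot all_order all_algebra.
From mathcomp Require Import complex.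
From mathcomp Require Import all_classical all_reals all_analysis.
From mathcomp Require Import ring lra.
Import Order.TTheory GRing.Theory Num.Theory.
Local Open Scope classical_set_scope.
Local Open Scope ring_scope.
Local Open Scope complex_scope.

(** * Numerical bounds on powers of [2 + sqrt 3] *)

(** Bernoulli's inequality for the base [e^u]: write [e^(t u) = e^u e^((t - 1) u)] and use
    [e^v >= 1 + v] at [v = (t - 1) u] and at [v = - u]. *)
Lemma expR_mul_ge_bernoulli (R : realType) (t u : R) :
  1 <= t -> 1 + t * (expR u - 1) <= expR (t * u).
Proof.
move=> t1.
have -> : t * u = u + (t - 1) * u by ring.
rewrite expRD.
have h1 := expR_ge1Dx ((t - 1) * u).
have h2 := expR_ge1Dx (- u).
have u0 := expR_gt0 u.
have h3 : expR u * (1 - u) <= 1.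
  by rewrite -[leRHS](expRxMexpNx_1 u) ler_wpM2l // ltW.
have h4 : expR u * (1 + (t - 1) * u) <= expR u * expR ((t - 1) * u).
  by rewrite ler_wpM2l // ltW.
by nra.
Qed.

Lemma two_plus_sqrt3_ge (R : realType) : 373 / 100 <= 2 + Num.sqrt 3 :> R.
Proof.
have h : 173 / 100 <= Num.sqrt 3 :> R.
  by rewrite -[leLHS]ger0_norm -?sqrtr_sqr ?ler_sqrt; lra.
lra.
Qed.

(** Replacing the exponent [t] by the smaller rational [p / q] leaves a comparison of integer
    powers. *)
Lemma expR_mul_ln_ge (R : realType) (p q : nat) (a b t : R) :
  (0 < q)%N -> 1 < b -> 0 <= a -> a ^+ q <= b ^+ p -> p%:R <= q%:R * t ->
  a <= expR (t * ln b).
Proof.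
move=> q0 b1 a0 hab hpq.
have b0 : 0 < b by lra.
rewrite -(@ler_pXn2r _ q) ?nnegrE ?expR_ge0 // (le_trans hab) //.
have {1}-> : b = expR (ln b) by rewrite lnK ?posrE.
by rewrite -!expRM_natl ler_expR mulrA ler_wpM2r // ln_ge0 // ltW.
Qed.

(* Bernoulli with exponent [s / 2 >= 1], from [(12 / 5) ^ 3 < (2 + sqrt 3) ^ 2]. *)
Lemma two_plus_sqrt3_powR_ge (R : realType) (s : R) : 2 <= s ->
  1 + 3 * s ^+ 2 <= expR (s * ln (2 + Num.sqrt 3)).
Proof.
move=> s2; set b := 2 + _.
have hb : 373 / 100 <= b := two_plus_sqrt3_ge R.
have b0 : 0 < b by lra.
have c0 : (0 : R) < 12 / 5 by lra.
have hc : 3 * ln (12 / 5) <= 2 * ln b.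
  rewrite -ler_expR !expRM_natl !lnK ?posrE //; nra.
have h : expR (3 * (s / 2 * ln (12 / 5))) <= expR (s * ln b).
  by rewrite ler_expR; nra.
apply: le_trans h; rewrite expRM_natl.
have := @expR_mul_ge_bernoulli R (s / 2) (ln (12 / 5)).
rewrite lnK ?posrE // => h.
have {}h : 1 + 7 / 10 * s <= expR (s / 2 * ln (12 / 5)).
  by apply: le_trans (h _); lra.
apply: (@le_trans _ _ ((1 + 7 / 10 * s) ^+ 3)).
  (* This quadratic, of negative discriminant, is [1000 / s] times
     [(1 + 7 s / 10)^3 - (1 + 3 s^2)]. *)
  have q0 : 0 <= 2100 - 1530 * s + 343 * s ^+ 2.
    by have := sqr_ge0 (343 * s - 765); nra.
  by nra.
rewrite lerXn2r ?nnegrE ?expR_ge0 //; lra.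
Qed.

(* [expR (2/3) <= (1 - 1/24)^-16 < 2] *)
Lemma expR_two_thirds_lt2 (R : realType) : expR (2 / 3) < 2 :> R.
Proof.
have h : (23 / 24) ^+ 16 <= expR (- (2 / 3)) :> R.
  have -> : - (2 / 3) = 16%:R * - (1 / 24) :> R by lra.
  rewrite expRM_natl lerXn2r ?nnegrE ?expR_ge0 //.
  by have := @expR_ge1Dx R (- (1 / 24)); lra.
have h1 := expRxMexpNx_1 (2 / 3 : R).
have h0 := expR_gt0 (2 / 3 : R).
nra.
Qed.

(* The mass is not monotone in [d]: the uniform bound needs [d >= 4], and the
   cases [d = 2, 3] use [sqrt 2 > 7 / 5] and [sqrt 3 > 5 / 3]. *)
Lemma lattice_mass_lt2 (R : realType) (d : nat) : (0 < d)%N ->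
  let E := expR (Num.sqrt d%:R * ln (2 + Num.sqrt 3)) : R in
  1 < E /\ ((E + 1) / (E - 1)) ^+ d < 2.
Proof.
move=> d0 E.
have hb := two_plus_sqrt3_ge R.
have b1 : 1 < 2 + Num.sqrt 3 :> R by lra.
have frac_le (a u : R) : 1 < a -> a <= E -> a + 1 <= u * (a - 1) ->
    0 <= (E + 1) / (E - 1) <= u.
  move=> a1 aE hu; apply/andP; split; first by rewrite divr_ge0 //; lra.
  by rewrite ler_pdivrMr; nra.
have pow_lt (u : R) : 0 <= (E + 1) / (E - 1) <= u -> u ^+ d < 2 ->
    ((E + 1) / (E - 1)) ^+ d < 2.
  move=> /andP[h0 hu]; apply: le_lt_trans.
  by rewrite lerXn2r ?nnegrE // (le_trans h0).
have root_ge (a : R) : 0 <= a -> a ^+ 2 <= d%:R -> a <= Num.sqrt d%:R.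
  by move=> a0 h; rewrite -[leLHS]ger0_norm // -sqrtr_sqr ler_sqrt.
have [d4|] := leqP 4 d.
  have d4' : 4 <= d%:R :> R by rewrite ler_nat.
  have hE : 1 + 3 * d%:R <= E.
    rewrite -[d%:R in leLHS]sqr_sqrtr ?ler0n //.
    by apply: two_plus_sqrt3_powR_ge; apply: root_ge; lra.
  split; first lra.
  (* The [d]-th power of this upper bound is [e^(2/3)], whatever [d]. *)
  have : 0 <= (E + 1) / (E - 1) <= expR (2 / 3 / d%:R).
    have /andP[-> h] : 0 <= (E + 1) / (E - 1) <= 1 + 2 / 3 / d%:R.
      apply: (frac_le (1 + 3 * d%:R)) => //; first lra.
      have -> : (1 + 2 / 3 / d%:R) * (1 + 3 * d%:R - 1) = 3 * d%:R + 2 :> R.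
        by field; lra.
      lra.
    by rewrite (le_trans h) ?expR_ge1Dx.
  move/pow_lt; apply.
  by rewrite -expRM_natl mulrC divfK ?expR_two_thirds_lt2 //; lra.
case: d d0 @E frac_le pow_lt root_ge => [|[|[|[|//]]]] // _ E frac_le pow_lt root_ge _.
(* For [d = 1] the mass is exactly [sqrt 3]. *)
- have EE : E = 2 + Num.sqrt 3 by rewrite /E sqrtr1 mul1r lnK ?posrE //; lra.
  split; first by rewrite EE.
  rewrite expr1 ltr_pdivrMr EE; lra.
- have hE : 6 <= E.
    apply: (@expR_mul_ln_ge _ 7 5) => //.
      apply: (@le_trans _ _ ((373 / 100) ^+ 7)); first by lra.
      by rewrite lerXn2r ?nnegrE //; lra.
    by have := root_ge (7 / 5); lra.
  split; first lra.
  (* [7 / 5] is [(6 + 1) / (6 - 1)], with square [49 / 25]; likewise [99 / 79] below comes from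
     [E >= 89 / 10]. *)
  apply: (pow_lt (7 / 5)); first by apply: (frac_le 6); lra.
  lra.
- have hE : 89 / 10 <= E.
    apply: (@expR_mul_ln_ge _ 5 3) => //.
      apply: (@le_trans _ _ ((373 / 100) ^+ 5)); first by lra.
      by rewrite lerXn2r ?nnegrE //; lra.
    by have := root_ge (5 / 3); lra.
  split; first lra.
  apply: (pow_lt (99 / 79)); first by apply: (frac_le (89 / 10)); lra.
  lra.
Qed.

(** * Geometric sums over integer vectors *)

Lemma ler_sum_inj (R : numDomainType) (I J : finType) (h : I -> J)
  (F : J -> R) : injective h -> (forall j, 0 <= F j) ->
  \sum_i F (h i) <= \sum_j F j.
Proof.
move=> hinj F0; rewrite -(big_imset _ (in2W hinj)) /=.
rewrite [leRHS](bigID (mem [set h i | i in predT]%SET)) /=.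
by rewrite lerDl sumr_ge0.
Qed.

Lemma geometric_sum_le (R : realType) (r : R) (N : nat) :
  0 < r < 1 -> \sum_(k < N) r ^+ k <= (1 - r)^-1.
Proof.
move=> /andP[r0 r1].
rewrite -[leRHS]mul1r.
apply: le_trans (geometric_le_lim N ler01 r0 _); last by rewrite gtr0_norm.
by rewrite /series /= big_mkord; apply: ler_sum => i _; rewrite mul1r.
Qed.

(* An integer in [-N-1, N] is coded by its constructor ([Posz] or [Negz])
   together with the argument of that constructor. *)
Definition int_code (N : nat) (m : int) : 'I_N.+1 + 'I_N.+1 :=
  match m with Posz k => inl (inord k) | Negz k => inr (inord k) end.

Definition int_decode (N : nat) (s : 'I_N.+1 + 'I_N.+1) : int :=
  match s with inl k => Posz k | inr k => Negz k end.

Lemma int_codeK (N : nat) (m : int) : (`|m| <= N)%N ->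
  int_decode N (int_code N m) = m.
Proof. by case: m => k /= hk; rewrite inordK // ltnW. Qed.

(** The nonnegative integers contribute at most [1 / (1 - r)]; since [Negz k] has absolute value
    [k + 1], the negative ones contribute at most [r / (1 - r)]. *)
Lemma sum_int_decode_le (R : realType) (r : R) (N : nat) : 0 < r < 1 ->
  \sum_s r ^+ `|int_decode N s|%N <= (1 + r) / (1 - r).
Proof.
move=> hr; rewrite big_sumType /= mulrDl mul1r lerD ?geometric_sum_le //.
under eq_bigr do rewrite exprS.
rewrite -mulr_sumr ler_wpM2l ?geometric_sum_le //.
by case/andP: hr => /ltW.
Qed.

(** The finitely many vectors lie in a box; the sum over the whole box factors into [d] equal
    one-dimensional sums. *)
Lemma lattice_sum_le (R : realType) (r : R) (d : nat) (I : finType)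
  (mu : I -> 'rV[int]_d) : 0 < r < 1 -> injective mu ->
  \sum_i \prod_(j < d) r ^+ `|mu i 0%R j|%N <= ((1 + r) / (1 - r)) ^+ d.
Proof.
move=> hr muinj.
pose N := (\max_i \max_j `|mu i 0%R j|)%N.
have muN i j : (`|mu i 0%R j| <= N)%N.
  rewrite /N; apply: leq_trans (leq_bigmax i).
  exact: (leq_bigmax (F := fun j => `|mu i 0%R j|%N)).
pose h i : {ffun 'I_d -> 'I_N.+1 + 'I_N.+1} :=
  [ffun j => int_code N (mu i 0 j)].
have hinj : injective h.
  move=> i1 i2 /ffunP e; apply: muinj; apply/rowP => j.
  by rewrite -(int_codeK _ _ (muN i1 j)) -(int_codeK _ _ (muN i2 j));
    have := e j; rewrite !ffunE => ->.
have r0 : 0 <= r by case/andP: hr => /ltW.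
pose F (f : {ffun 'I_d -> 'I_N.+1 + 'I_N.+1}) :=
  \prod_(j < d) r ^+ `|int_decode N (f j)|%N.
have -> : \sum_i \prod_(j < d) r ^+ `|mu i 0%R j|%N = \sum_i F (h i).
  apply: eq_bigr => i _; apply: eq_bigr => j _.
  by rewrite ffunE int_codeK.
apply: le_trans (ler_sum_inj _ _ _ _ F hinj _) _.
  by move=> f; apply: prodr_ge0 => j _; exact: exprn_ge0.
rewrite /F -(bigA_distr_bigA (fun j s => r ^+ `|int_decode N s|%N)).
rewrite prodr_const card_ord lerXn2r ?nnegrE ?sum_int_decode_le //.
  by apply: sumr_ge0 => s _; exact: exprn_ge0.
by case/andP: hr => *; rewrite divr_ge0 //; lra.
Qed.

(** * Comparison of the 1-norm and the Euclidean norm *)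

(** Cauchy-Schwarz against the constant vector, read off from the sum of the squares of [d a_j - S],
    where [S] is the sum of the [a_j]. *)
Lemma sqr_sum_le (R : realDomainType) (d : nat) (a : 'I_d -> R) :
  (\sum_j a j) ^+ 2 <= d%:R * \sum_j a j ^+ 2.
Proof.
case: d a => [|d] a; first by rewrite !big_ord0 expr0n mul0r.
set S := \sum_j a j; set Q := \sum_j _; set D := d.+1%:R.
have D0 : 0 < D by rewrite ltr0Sn.
have : 0 <= \sum_j (D * a j - S) ^+ 2 by apply: sumr_ge0 => j _; exact: sqr_ge0.
have -> : \sum_j (D * a j - S) ^+ 2 = D * (D * Q - S ^+ 2).
  transitivity (\sum_(j < d.+1)
     (D ^+ 2 * a j ^+ 2 - 2 * D * S * a j + S ^+ 2)).
    by apply: eq_bigr => j _; ring.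
  rewrite big_split /= sumrB -!mulr_sumr sumr_const card_ord -mulr_natl.
  by rewrite -/D -/S -/Q; ring.
by rewrite pmulr_rge0 // subr_ge0.
Qed.

Definition int_norm2 (R : realType) (d : nat) (m : 'rV[int]_d) : R :=
  Num.sqrt (\sum_j (m 0 j)%:~R ^+ 2).

Lemma norm1_le_sqrt_norm2 (R : realType) (d : nat) (m : 'rV[int]_d) :
  (\sum_j `|m 0%R j|)%N%:R <= Num.sqrt d%:R * int_norm2 R d m.
Proof.
rewrite -sqrtrM ?ler0n // -[leLHS]ger0_norm ?ler0n // -sqrtr_sqr.
rewrite ler_wsqrtr // natr_sum (le_trans (sqr_sum_le _ _ _)) //.
rewrite le_eqVlt; apply/orP; left; apply/eqP; congr (_ * _).
apply: eq_bigr => j _.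
by rewrite natr_absz intr_norm real_normK ?num_real.
Qed.

(** * Distance to the tropical variety and dominance of one term *)

Lemma trop_polyE (R : realType) (d n : nat) (c : 'I_n.+1 -> R[i])
  (lambda : 'I_n.+1 -> 'rV[int]_d) (x : 'rV[R]_d) (k0 : 'I_n.+1) :
  (forall k, trop_term c lambda x k <= trop_term c lambda x k0) ->
  trop_poly c lambda x = trop_term c lambda x k0.
Proof.
move=> hk0; apply/eqP; rewrite eq_le; apply/andP; split.
  by apply/bigmax_leP; split=> [|k _]; exact: hk0.
exact: (le_bigmax _ _ k0).
Qed.

Lemma pairingDr (K : comNzRingType) (d : nat) (l : 'rV[int]_d) (x y : 'rV[K]_d) :
  pairing l (x + y) = pairing l x + pairing l y.
Proof.
by rewrite -big_split; apply: eq_bigr => j _; rewrite mxE mulrDr.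
Qed.

Lemma pairingZr (K : comNzRingType) (d : nat) (l : 'rV[int]_d) (t : K)
  (x : 'rV[K]_d) : pairing l (t *: x) = t * pairing l x.
Proof. by rewrite mulr_sumr; apply: eq_bigr => j _; rewrite mxE mulrCA. Qed.

Lemma pairingBl (K : comNzRingType) (d : nat) (l m : 'rV[int]_d) (x : 'rV[K]_d) :
  pairing (l - m) x = pairing l x - pairing m x.
Proof.
by rewrite -sumrB; apply: eq_bigr => j _; rewrite !mxE rmorphB mulrBl.
Qed.

Lemma trop_termD (R : realType) (d n : nat) (c : 'I_n.+1 -> R[i])
  (lambda : 'I_n.+1 -> 'rV[int]_d) (x y : 'rV[R]_d) (k : 'I_n.+1) :
  trop_term c lambda (x + y) k = trop_term c lambda x k + pairing (lambda k) y.
Proof. by rewrite /trop_term pairingDr addrA. Qed.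

Lemma eucl_dist_addr (R : realType) (d : nat) (x : 'rV[R]_d) (t : R)
  (m : 'rV[int]_d) : 0 <= t ->
  eucl_dist x (x + t *: map_mx intr m) = t * int_norm2 R d m.
Proof.
move=> t0; rewrite /eucl_dist -[t in RHS]ger0_norm // -sqrtr_sqr -sqrtrM ?sqr_ge0 //.
by rewrite mulr_sumr; congr Num.sqrt; apply: eq_bigr => j _; rewrite !mxE; ring.
Qed.

(* Moving from [x] in the direction [mu k = lambda k - lambda k0], the first
   term [j] to catch up with the leading term [k0] does so at a point of the
   tropical variety, and no later than [k] does. *)
Lemma trop_dominant_term (R : realType) (d n : nat) (c : 'I_n.+1 -> R[i])
  (lambda : 'I_n.+1 -> 'rV[int]_d) (hlambda : injective lambda)
  (delta : R) (x : 'rV[R]_d)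
  (hx : (delta%:E <= eucl_dist_set x (arch_trop_variety c lambda))%E) :
  exists k0 : 'I_n.+1, forall k,
    trop_term c lambda x k + delta * int_norm2 R d (lambda k - lambda k0)
      <= trop_term c lambda x k0.
Proof.
pose t k := trop_term c lambda x k.
pose k0 := [arg max_(k > ord0) t k]%O.
have hk0 k : t k <= t k0 by rewrite /k0; case: arg_maxP => // i _; apply.
exists k0 => k; rewrite leNgt; apply/negP => hk.
pose mu j := lambda j - lambda k0.
pose v : 'rV[R]_d := map_mx intr (mu k).
pose b j := pairing (mu j) v.
pose N := int_norm2 R d (mu k).
have bk : b k = N ^+ 2.
  rewrite /N sqr_sqrtr; last by apply: sumr_ge0 => j _; exact: sqr_ge0.
  by rewrite /b /pairing; apply: eq_bigr => j _; rewrite [v _ _]mxE expr2.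
(* If [N] vanished, [hk] would contradict the maximality of [k0]. *)
have N0 : 0 < N.
  rewrite lt_neqAle sqrtr_ge0 andbT; apply/eqP => N0.
  have : t k0 < t k by rewrite (lt_le_trans hk) // -/(mu k) -/N -N0 mulr0 addr0.
  by rewrite ltNge hk0.
have bk0 : 0 < b k by rewrite bk exprn_gt0.
(* Along [v] the gap [t k0 - t j] closes at rate [b j], hence at time [T j] when [b j > 0]; terms
   with [b j <= 0] never overtake. The index [k] is a legitimate seed for the minimum because
   [0 < b k]. *)
pose T j := (t k0 - t j) / b j.
pose j := [arg min_(j < k | 0 < b j) T j]%O.
have [bj Tj] : 0 < b j /\ forall i, 0 < b i -> T j <= T i.
  by rewrite /j; case: arg_minP => // i.
have Tj0 : 0 <= T j by rewrite divr_ge0 ?subr_ge0 // ltW.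
pose y := x + T j *: v.
have ty i : trop_term c lambda y i - trop_term c lambda y k0 =
    T j * b i - (t k0 - t i).
  by rewrite !trop_termD !pairingZr /b /mu pairingBl -/(t i) -/(t k0); ring.
have yk0 i : trop_term c lambda y i <= trop_term c lambda y k0.
  rewrite -subr_le0 ty subr_le0; have [bi|bi] := ltP 0 (b i).
    by rewrite -ler_pdivlMr // Tj.
  by rewrite (@le_trans _ _ 0) ?subr_ge0 // mulr_ge0_le0.
have yj : trop_term c lambda y j = trop_term c lambda y k0.
  by apply/eqP; rewrite -subr_eq0 ty divfK ?subrr // gt_eqF.
have yT : arch_trop_variety c lambda y.
  exists j, k0; rewrite (trop_polyE _ _ _ _ _ _ k0) //; split=> //.
  apply/eqP => jk0; move: bj; rewrite /b /mu jk0 subrr /pairing big1 ?ltxx //.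
  by move=> i _; rewrite mxE mul0r.
have : (delta%:E <= (eucl_dist x y)%:E)%E.
  by apply: le_trans hx _; apply: ereal_inf_lbound; exists y.
rewrite lee_fin eucl_dist_addr // leNgt => /negP; apply.
(* As [b k = N^2], this bound is [(t k0 - t k) / N], which [hk] makes smaller than [delta]. *)
apply: (@le_lt_trans _ _ (T k * N)); first by rewrite ler_wpM2r ?Tj // ltW.
rewrite /T bk expr2 invfM mulrA divfK ?gt_eqF // ltr_pdivrMr // ltrBlDl.
exact: hk.
Qed.

(** * Moduli of the exponential terms *)

Lemma normc_ler_sum (R : realType) (I : finType) (P : pred I) (F : I -> R[i]) :
  Normc.normc (\sum_(i | P i) F i) <= \sum_(i | P i) Normc.normc (F i).
Proof.
elim/big_ind2 : _ => [|x1 x2 y1 y2 h1 h2|//]; first by rewrite Normc.normc0.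
exact: le_trans (le_normcD _ _) (lerD h1 h2).
Qed.

Lemma normc_cexp (R : realType) (z : R[i]) :
  Normc.normc (cexp z) = expR (complex.Re z).
Proof.
rewrite /cexp Normc.normcM /= expr0n /= addr0 cos2Dsin2 sqrtr1 mulr1.
by rewrite sqrtr_sqr ger0_norm // expR_ge0.
Qed.

Lemma Re_pairing (R : realType) (d : nat) (l : 'rV[int]_d) (z : 'rV[R[i]]_d) :
  complex.Re (pairing l z) = pairing l (map_mx (@complex.Re R) z).
Proof.
rewrite /pairing raddf_sum; apply: eq_bigr => j _; rewrite mxE.
have -> : (l 0 j)%:~R = ((l 0 j)%:~R : R)%:C :> R[i] by rewrite rmorph_int.
by case: (z 0 j) => a b /=; rewrite mul0r subr0.
Qed.

Lemma normc_exp_term (R : realType) (d n : nat) (c : 'I_n.+1 -> R[i])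
  (lambda : 'I_n.+1 -> 'rV[int]_d) (k : 'I_n.+1) (z : 'rV[R[i]]_d) :
  c k != 0 ->
  Normc.normc (c k * cexp (pairing (lambda k) z)) =
  expR (trop_term c lambda (map_mx (@complex.Re R) z) k).
Proof.
move=> ck; rewrite Normc.normcM normc_cexp Re_pairing expRD lnK // posrE.
rewrite lt_neqAle eq_sym; apply/andP; split.
  by apply: contra ck => /eqP /Normc.eq0_normc ->.
by case: (c k) => a b; exact: sqrtr_ge0.
Qed.

Lemma geometric_ratio_invE (R : realFieldType) (a : R) : 1 < a ->
  (1 + a^-1) / (1 - a^-1) = (a + 1) / (a - 1).
Proof. by move=> a1; field; lra. Qed.

(** With [m = lambda k - lambda k0], one has [sqrt d L |m|_1 <= d L |m|_2 <= delta |m|_2]; the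
    product form is the one that sums over the lattice. *)
Lemma trop_term_lattice_decay (R : realType) (d n : nat) (c : 'I_n.+1 -> R[i])
  (lambda : 'I_n.+1 -> 'rV[int]_d) (L delta : R) (x : 'rV[R]_d)
  (k0 k : 'I_n.+1) : 0 <= L -> d%:R * L <= delta ->
  trop_term c lambda x k + delta * int_norm2 R d (lambda k - lambda k0)
    <= trop_term c lambda x k0 ->
  expR (trop_term c lambda x k) <= expR (trop_term c lambda x k0) *
    \prod_(j < d) expR (- (Num.sqrt d%:R * L)) ^+ `|(lambda k - lambda k0)%R 0%R j|%N.
Proof.
move=> L0 hdelta hk; set m := lambda k - lambda k0 in hk *.
rewrite prodrXr -expRM_natl -expRD ler_expR.
have h1 := norm1_le_sqrt_norm2 R d m.
set S := (_%:R) in h1 *; set N := int_norm2 R d m in hk h1 *.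
have N0 : 0 <= N by exact: sqrtr_ge0.
have s0 : 0 <= Num.sqrt d%:R :> R by exact: sqrtr_ge0.
have sd : Num.sqrt d%:R * Num.sqrt d%:R = d%:R :> R.
  by rewrite -expr2 sqr_sqrtr ?ler0n.
have h2 : Num.sqrt d%:R * L * S <= Num.sqrt d%:R * L * (Num.sqrt d%:R * N).
  by rewrite ler_wpM2l // mulr_ge0.
have h3 : Num.sqrt d%:R * L * (Num.sqrt d%:R * N) = d%:R * L * N.
  by rewrite -[in RHS]sd; ring.
have h4 : d%:R * L * N <= delta * N by rewrite ler_wpM2r.
lra.
Qed.

Theorem theorem1p2 (R : realType) (d n : nat) (hd : (1 <= d)%N)
  (c : 'I_n.+1 -> R[i]) (lambda : 'I_n.+1 -> 'rV[int]_d)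
  (hc : forall k, c k != 0) (hlambda : injective lambda)
  (delta : R) (hdelta : d%:R * ln (2 + Num.sqrt 3) <= delta)
  (x : 'rV[R]_d)
  (hx : (delta%:E <= eucl_dist_set x (arch_trop_variety c lambda))%E) :
  (~` amoeba (exp_sum c lambda)) x.
Proof.
case=> z /= fz xz.
set L := ln (2 + Num.sqrt 3) in hdelta.
have L0 : 0 <= L by rewrite ln_ge0 //; have := two_plus_sqrt3_ge R; lra.
have [k0 hk0] := trop_dominant_term _ _ _ _ _ hlambda _ _ hx.
have [E1 mass] := lattice_mass_lt2 R d hd.
rewrite -/L in E1 mass; set E := expR _ in E1 mass.
pose r := expR (- (Num.sqrt d%:R * L)).
have rE : r = E^-1 by rewrite /r expRN.
have r01 : 0 < r < 1 by rewrite expR_gt0 rE invf_lt1 //; lra.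
have rmass : (1 + r) / (1 - r) = (E + 1) / (E - 1).
  by rewrite rE geometric_ratio_invE.
pose mu k := lambda k - lambda k0.
have muinj : injective mu by move=> k l /addIr /hlambda.
have := lattice_sum_le _ _ _ _ mu r01 muinj.
rewrite rmass => /le_lt_trans /(_ mass).
(* The index [k0] gives the zero vector and contributes [1], so the other indices share less than
   [2 - 1]. *)
rewrite (bigD1 k0) //= big1 //; last first.
  by move=> j _; rewrite /mu subrr mxE.
set S := \sum_(k | _) _ => S1.
(* At a zero of the sum the leading term is minus the sum of the others; the triangle inequality
   applies. *)
have lead : expR (trop_term c lambda x k0) <=
    \sum_(k | k != k0) expR (trop_term c lambda x k).
  rewrite -xz -normc_exp_term //.
  under eq_bigr do rewrite -normc_exp_term //.
  move: fz; rewrite /exp_sum (bigD1 k0) //= => /eqP; rewrite addr_eq0 => /eqP ->.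
  by rewrite normcN normc_ler_sum.
have tail : \sum_(k | k != k0) expR (trop_term c lambda x k) <=
    expR (trop_term c lambda x k0) * S.
  rewrite mulr_sumr; apply: ler_sum => k _.
  exact: trop_term_lattice_decay hdelta (hk0 k).
have := le_trans lead tail; rewrite leNgt => /negP; apply.
rewrite -[ltRHS]mulr1 ltr_pM2l ?expR_gt0 //; lra.
Qed.
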